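(* Let $d$ be prime, $n\ge1$, $G$ positive and invertible over $\mathbb Z_d$, and $\sigma$ a pure $n$-qudit state. Then the channel $\mathcal E_\sigma(\rho)=\rho\boxtimes\sigma$ has Holevo capacity $\chi_H(\mathcal E_\sigma)=n\log d$ (the maximal possible value) if and only if $\sigma$ is a stabilizer state.
   Context: Fix a prime $d$; $\chi(k)=e^{2\pi ik/d}$, $X|k\rangle=|k+1\rangle$, $Z|k\rangle=\chi(k)|k\rangle$ on $\mathbb C^d$; Weyl operators $w(p,q)=\chi(-2^{-1}pq)Z^pX^q$ (odd $d$), $w(p,q)=i^{-pq}Z^pX^q$ ($d=2$), $w(\vec p,\vec q)=\bigotimes_kw(p_k,q_k)$. A pure stabilizer state is a common eigenvector of an abelian group of $d^n$ Weyl operators (up to phases). $G=\begin{pmatrix}g_{00}&g_{01}\\ g_{10}&g_{11}\end{pmatrix}$ over $\mathbb Z_d$, $\det G\not\equiv0$, $N=(\det G)^{-1}$; positive means all entries nonzero mod $d$. Key unitary $U|\vec i\rangle|\vec j\rangle=|Ng_{11}\vec i-Ng_{10}\vec j\rangle|-Ng_{01}\vec i+Ng_{00}\vec j\rangle$; $\rho\boxtimes\sigma=\mathrm{Tr}_B[U(\rho\otimes\sigma)U^\dagger]$. Holevo capacity: $\chi_H(\mathcal E)=\max_{\{p_i,\rho_i\}}\big[H(\sum_ip_i\mathcal E(\rho_i))-\sum_ip_iH(\mathcal E(\rho_i))\big]$, $H$ von Neumann entropy. *)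

(* Defs.v *)
From HB Require Import structures.
From mathcomp Require Import all_boot all_order all_algebra.
From mathcomp Require Import boolp classical_sets reals exp trigo.
From mathcomp Require Import complex.
Set Implicit Arguments. Unset Strict Implicit. Unset Printing Implicit Defensive.
Import Order.TTheory GRing.Theory Num.Theory.
Local Open Scope ring_scope.
Local Open Scope complex_scope.

Section QDefs.
Variable R : realType.
Local Notation C := R[i].

(* Generic operators on the Hilbert space with orthonormal basis indexed by a finType T *)
Definition Op (T : finType) := 'M[C]_#|T|.
Definition mxF (T : finType) (f : T -> T -> C) : Op T :=
  \matrix_(i, j) f (enum_val i) (enum_val j).
Definition ent (T : finType) (A : Op T) (x y : T) : C := A (enum_rank x) (enum_rank y).

Definition adjmx m k (A : 'M[C]_(m, k)) : 'M[C]_(k, m) := \matrix_(i, j) (A j i)^*.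

Definition tensor (T1 T2 : finType) (A : Op T1) (B : Op T2) : Op (T1 * T2)%type :=
  mxF (fun x y => ent A x.1 y.1 * ent B x.2 y.2).
Definition ptraceB (T1 T2 : finType) (M : Op (T1 * T2)%type) : Op T1 :=
  mxF (fun a a' => \sum_(b : T2) ent M (a, b) (a', b)).

Definition is_density (T : finType) (rho : Op T) : Prop :=
  (forall v : 'cV[C]_#|T|, 0 <= (adjmx v *m rho *m v) 0 0) /\ \tr rho = 1.

Definition spectrum n (A : 'M[C]_n) : seq C :=
  xget [::] [set s : seq C | char_poly A = \prod_(x <- s) ('X - x%:P)].
Definition vN_entropy n (A : 'M[C]_n) : R :=
  - \sum_(l <- spectrum A) (complex.Re l * ln (complex.Re l)).

Definition holevo_quantities (T1 T2 : finType) (E : Op T1 -> Op T2) : set R :=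
  [set x | exists (m : nat) (p : 'I_m -> R) (rhos : 'I_m -> Op T1),
      (forall k, 0 <= p k) /\ \sum_(k < m) p k = 1 /\ (forall k, is_density (rhos k)) /\
      x = vN_entropy (\sum_(k < m) (p k)%:C *: E (rhos k))
          - \sum_(k < m) p k * vN_entropy (E (rhos k))].
Definition holevo_capacity (T1 T2 : finType) (E : Op T1 -> Op T2) : R :=
  sup (holevo_quantities E).

Variable d : nat.
(* computational basis labels of n qudits: vectors in Z_d^n *)
Definition Idx (n : nat) := {ffun 'I_n -> 'F_d}.

Definition omega : C := cos (2 * pi / d%:R) +i* sin (2 * pi / d%:R).
Definition chi (k : 'F_d) : C := omega ^+ (val k).

(* single-qudit Weyl operator w(p,q) as a function of (row k', column k):
   Z^p X^q |k> = chi(p (k+q)) |k+q>, with phase chi(-2^{-1} p q) (d odd) or i^{-pq} (d = 2) *)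
Definition weyl_phase (p q : 'F_d) : C :=
  if d == 2%N then ('i ^+ (val p * val q))^-1 else chi (- (2%:R)^-1 * p * q).
Definition weyl1 (p q : 'F_d) (k' k : 'F_d) : C :=
  weyl_phase p q * (if k' == k + q then chi (p * (k + q)) else 0).
Definition weyl n (pq : (Idx n * Idx n)%type) : Op (Idx n) :=
  mxF (fun k' k : Idx n => \prod_(j < n) weyl1 (pq.1 j) (pq.2 j) (k' j) (k j)).

(* pure stabilizer state: common eigenvector of an abelian group of d^n Weyl
   operators (up to phases); the labels of the group form a subgroup S of Z_d^{2n} *)
Definition stabilizer_state n (psi : 'cV[C]_#|Idx n|) : Prop :=
  exists S : {set (Idx n * Idx n)%type},
    [/\ #|S| = (d ^ n)%N, 0 \in S, {in S &, forall u v, u + v \in S},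
        {in S &, forall u v, weyl u *m weyl v = weyl v *m weyl u}
      & {in S, forall u, exists c : C, weyl u *m psi = c *: psi}].

Definition key_map n (G : 'M['F_d]_2) (x : (Idx n * Idx n)%type) : (Idx n * Idx n)%type :=
  let N := (\det G)^-1 in
  ([ffun k => N * G 1 1 * x.1 k - N * G 1 0 * x.2 k],
   [ffun k => - (N * G 0 1) * x.1 k + N * G 0 0 * x.2 k]).
Definition key_unitary n (G : 'M['F_d]_2) : Op ((Idx n * Idx n)%type) :=
  mxF (fun y x : (Idx n * Idx n)%type => if y == key_map G x then 1 else 0).
Definition boxtimes n (G : 'M['F_d]_2) (rho sigma : Op (Idx n)) : Op (Idx n) :=
  ptraceB (key_unitary n G *m tensor rho sigma *m adjmx (key_unitary n G)).

End QDefs.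

(* Main.v *)
Require Import Defs.
From HB Require Import structures.
From mathcomp Require Import all_boot all_order all_algebra.
From mathcomp Require Import boolp classical_sets reals exp trigo.
From mathcomp Require Import complex.
From mathcomp Require Import ring lra.
Set Implicit Arguments.
Unset Strict Implicit.
Unset Printing Implicit Defensive.
Import Order.TTheory GRing.Theory Num.Theory.
Local Open Scope ring_scope.

(** In terms of the characteristic function [charf f (p, q) = tr (Z^p X^q f)], the convolution is
    a product: [charf (f box h) u = charf f (A u) * charf h (B u)] with [A], [B] diagonal
    invertible maps on phase space.

    If the capacity is [n ln d], there are inputs whose outputs have arbitrarily small entropy,
    hence purity at least [1 - eps].  With [a = |charf f (A u)|^2] and [b = |charf h (B u)|^2], both
    in [0, 1], Parseval turns this into [sum_u (a (1 - b) + b (1 - a)) <= 2 d^n eps], and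
    [b (1 - b)] is at most this sum.  So [|charf h|] is 0 or 1 everywhere, with no compactness
    argument, and by Parseval it is 1 at exactly [d^n] points, i.e. [d^n] Weyl operators have the
    pure state [h] as an eigenvector.

    Conversely, [A B^-1] multiplies the symplectic form by a scalar, so it maps the isotropic label
    group of a stabilizer state to an isotropic set; the members of a common orthonormal eigenbasis
    of the corresponding Weyl operators are inputs with pure outputs, and their uniform mixture
    [I / d^n] is sent to itself. *)

(** * Bounds on the Shannon entropy of a finite distribution *)

Section Entropy.
Variable R : realType.
Implicit Types x y : R.

(** This is [ln t <= t - 1] at [t = y / x], multiplied by [x]; at [x = 0] the left side is 0
    whatever value [ln 0] takes. *)
Lemma gibbs_term x y : 0 <= x -> 0 < y -> x * (ln y - ln x) <= y - x.
Proof.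
rewrite le_eqVlt => /predU1P[<-|x0] y0; first by rewrite mul0r subr0 ltW.
have -> : y - x = x * (y / x - 1) by rewrite mulrBr mulr1 mulrCA divff ?gt_eqF ?mulr1.
rewrite ler_pM2l // -ln_div ?posrE //.
have := @le_ln1Dx R (y / x - 1); rewrite (_ : 1 + _ = y / x); last by ring.
by apply; rewrite ltrBDr addNr divr_gt0.
Qed.

Variables (n : nat) (l : 'I_n -> R).
Hypotheses (l_ge0 : forall i, 0 <= l i) (l_sum : \sum_i l i = 1).

(** Sum [gibbs_term] against the uniform distribution. *)
Lemma shannon_le_ln : - \sum_i (l i * ln (l i)) <= ln n%:R.
Proof.
have n_gt0 : 0 < n%:R :> R.
  rewrite ltr0n; case: (n) l l_sum => // l' /eqP.
  by rewrite big_ord0 eq_sym oner_eq0.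
have : \sum_i (l i * (ln (n%:R^-1) - ln (l i))) <= \sum_i (n%:R^-1 - l i).
  by apply: ler_sum => i _; rewrite gibbs_term ?invr_gt0.
rewrite sumrB sumr_const card_ord -[_^-1 *+ n]mulr_natl divff ?gt_eqF // l_sum subrr.
under eq_bigr do rewrite mulrBr.
by rewrite sumrB -mulr_suml l_sum mul1r lnV ?posrE //; lra.
Qed.

(** Gibbs' inequality against the distribution [l i ^+ 2 / P]: the Renyi entropy of order 2 lies
    below the Shannon entropy. It later gives the entropy of the maximally mixed state from its
    purity alone. *)
Lemma shannon_ge_lnsq : - ln (\sum_i l i ^+ 2) <= - \sum_i (l i * ln (l i)).
Proof.
set P := \sum_i _.
have P_gt0 : 0 < P.
  rewrite lt_neqAle sumr_ge0 ?andbT => [|i _]; last exact: sqr_ge0.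
  apply/eqP => /esym/eqP; rewrite psumr_eq0 => [/allP l0|i _]; last exact: sqr_ge0.
  have : \sum_i l i = 0.
    apply: big1 => i _; apply/eqP.
    by have := l0 i (mem_index_enum _); rewrite /= sqrf_eq0.
  by move/eqP; rewrite l_sum oner_eq0.
rewrite lerN2.
have : \sum_i (l i * (ln (l i) - ln P)) <= \sum_i (l i ^+ 2 / P - l i).
  apply: ler_sum => i _; have := l_ge0 i; rewrite le_eqVlt.
  case/predU1P=> [<-|li0]; first by rewrite mul0r expr0n mul0r subr0.
  have := @gibbs_term (l i) (l i ^+ 2 / P) (ltW li0).
  rewrite divr_gt0 ?exprn_gt0 // => /(_ isT); apply: le_trans.
  rewrite ln_div ?posrE ?exprn_gt0 // lnXn // mulr2n.
  by rewrite le_eqVlt (_ : _ - _ - ln (l i) = ln (l i) - ln P) ?eqxx //; ring.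
rewrite sumrB l_sum -mulr_suml divff ?gt_eqF // subrr.
under eq_bigr do rewrite mulrBr.
by rewrite sumrB -mulr_suml l_sum mul1r subr_le0.
Qed.

Lemma sum_sq_le1 : \sum_i l i ^+ 2 <= 1.
Proof.
rewrite -[leRHS]l_sum; apply: ler_sum => i _; rewrite expr2 ler_piMr //.
by rewrite -l_sum (bigD1 i) //= lerDl sumr_ge0.
Qed.

(** Termwise, [ln t <= t - 1] at [t = 1 / l] gives [l - 1 <= - ln (1 / l)] up to sign, hence
    [l - l ^+ 2 <= - l * ln l]. This form turns small entropy into purity close to 1. *)
Lemma shannon_ge_linear : 1 - \sum_i l i ^+ 2 <= - \sum_i (l i * ln (l i)).
Proof.
rewrite lerNr opprB lerBrDr -[in leLHS]l_sum -big_split /=; apply: ler_sum => i _.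
rewrite -lerBrDr; have := l_ge0 i; rewrite le_eqVlt => /predU1P[<-|li0].
  by rewrite mul0r expr0n subr0.
rewrite -[X in _ - X]mulr1 expr2 -mulrBr ler_pM2l //.
by have := gibbs_term ler01 li0; rewrite mul1r ln1 subr0.
Qed.

(** The terms [l i * (1 - l i)] are nonnegative and sum to 0, so every [l i] is 0 or 1, where
    [l * ln l] vanishes. *)
Lemma shannon_eq0 : \sum_i l i ^+ 2 = 1 -> - \sum_i (l i * ln (l i)) = 0.
Proof.
move=> l2; suff l01 i : l i * (1 - l i) = 0.
  rewrite big1 ?oppr0 // => i _; have /eqP := l01 i.
  rewrite mulf_eq0 subr_eq0 => /orP[/eqP->|/eqP<-]; first by rewrite mul0r.
  by rewrite ln1 mulr0.
have l_le1 j : l j <= 1 by rewrite -l_sum (bigD1 j) //= lerDl sumr_ge0.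
have : \sum_i (l i * (1 - l i)) == 0.
  under eq_bigr do rewrite mulrBr mulr1 -expr2.
  by rewrite sumrB l_sum l2 subrr.
rewrite psumr_eq0 => [/allP/(_ i (mem_index_enum _))/eqP//|j _].
by rewrite mulr_ge0 // subr_ge0.
Qed.

End Entropy.

(** Lets one equation follow from another by a [ring] identity between the differences of their
    sides. *)
Lemma eq_of_subr_eq (V : zmodType) (a b c d : V) : a = b -> c - d = a - b -> c = d.
Proof. by move=> -> /eqP; rewrite subrr subr_eq0 => /eqP. Qed.

(** * Positive semidefinite kernels on a finite set *)

Section Kernels.
Variables (C : numClosedFieldType) (T : finType).
Implicit Types (f : T -> T -> C) (v : T -> C).

(** Operators are treated as kernels on the label set itself, so that affine maps of labels act on
    the arguments directly. *)
Definition qform f v : C := \sum_x \sum_y (v x)^* * f x y * v y.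
(** The squared Hilbert-Schmidt norm, which is [tr (f^2)] for Hermitian [f]. *)
Definition purity f : C := \sum_x \sum_y `|f x y| ^+ 2.
Definition poskernel f := forall v, 0 <= qform f v.

Lemma sum_delta2 (i j : T) (a b : C) (F : T -> C) :
  \sum_x (a * (x == i)%:R + b * (x == j)%:R) * F x = a * F i + b * F j.
Proof.
under eq_bigr do rewrite mulrDl.
rewrite big_split /= (bigD1 i) //= big1 ?addr0 => [|x /negbTE->]; last first.
  by rewrite mulr0 mul0r.
rewrite eqxx mulr1; congr (_ + _).
rewrite (bigD1 j) //= big1 ?addr0 => [|x /negbTE->]; last by rewrite mulr0 mul0r.
by rewrite eqxx mulr1.
Qed.

(** Writing the test vector as a sum of two deltas keeps the formula valid for [i = j]. *)
Lemma qform2 f (i j : T) (a b : C) :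
  qform f (fun x => a * (x == i)%:R + b * (x == j)%:R) =
  a^* * (a * f i i + b * f i j) + b^* * (a * f j i + b * f j j).
Proof.
rewrite /qform -(sum_delta2 i j _ _ (fun x => a * f x i + b * f x j)).
apply: eq_bigr => x _; rewrite rmorphD !rmorphM /= !conjC_nat.
rewrite -(sum_delta2 i j _ _ (fun y => f x y)) mulr_sumr.
by apply: eq_bigr => y _; rewrite -mulrA (mulrC (f x y)).
Qed.

Lemma poskernel_diag_ge0 f i : poskernel f -> 0 <= f i i.
Proof.
move=> /(_ (fun x => 1 * (x == i)%:R + 0 * (x == i)%:R)).
by rewrite qform2 conjC0 conjC1 !(mul0r, addr0, mul1r).
Qed.

(** Polarization: the form is real at [e_i + e_j] and at [e_i + 'i e_j], and these two facts
    together determine [f j i] from [f i j]. *)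
Lemma poskernel_hermitian f i j : poskernel f -> f j i = (f i j)^*.
Proof.
move=> pf.
have cj x : 0 <= x -> x^* = x :> C by move=> /ger0_real/CrealP.
have Ai := cj _ (poskernel_diag_ge0 i pf).
have Aj := cj _ (poskernel_diag_ge0 j pf).
have := cj _ (pf (fun x => 1 * (x == i)%:R + 1 * (x == j)%:R)).
rewrite qform2 !(rmorphD, rmorphM, conjC1) /= !mul1r Ai Aj => e1.
have := cj _ (pf (fun x => 1 * (x == i)%:R + 'i * (x == j)%:R)).
rewrite qform2 !(rmorphD, rmorphM, conjC1, conjCK) /= !mul1r Ai Aj conjCi => e2.
rewrite rmorphN /= conjCi opprK conjC1 !mul1r in e2.
have i0 : 'i != 0 :> C by exact: neq0Ci.
have {}e1 : (f i j)^* + (f j i)^* = f i j + f j i.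
  by apply: (eq_of_subr_eq e1); ring.
have {}e2 : (f j i)^* - (f i j)^* = f i j - f j i.
  apply: (mulfI i0); apply: (eq_of_subr_eq e2); ring.
apply: (@mulIf _ 2%:R); first by rewrite pnatr_eq0.
by apply: (eq_of_subr_eq (esym (congr2 (fun x y => x - y) e1 e2))); ring.
Qed.

(** Evaluate the form at [e_i - s e_j], where the unit scalar [s] is chosen so that both cross terms
    become [- |f i j|]. The additive bound, unlike the one by a geometric mean, can be summed
    directly. *)
Lemma poskernel_offdiag f i j : poskernel f -> 2%:R * `|f i j| <= f i i + f j j.
Proof.
move=> pf; have [->|z0] := eqVneq (f i j) 0.
  by rewrite normr0 mulr0 addr_ge0 // poskernel_diag_ge0.
set z := f i j in z0 *; have n0 : `|z| != 0 by rewrite normr_eq0.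
have := pf (fun x => 1 * (x == i)%:R + - (z^* / `|z|) * (x == j)%:R).
rewrite qform2 (poskernel_hermitian i j pf) -/z conjC1 !mul1r.
rewrite rmorphN rmorphM /= conjCK fmorphV /= conj_normC.
have zz : z * z^* = `|z| * `|z| by rewrite -normCK expr2.
set s := z^* / `|z|; set t := z / `|z|.
have zs : z * s = `|z| by rewrite mulrA zz mulfK.
have tz : t * z^* = `|z| by rewrite mulrAC zz mulfK.
have ts : t * s = 1 by rewrite mulrACA zz -invfM divff // mulf_neq0.
have -> : f i i + - s * z + - t * (z^* + - s * f j j) =
    f i i - z * s - t * z^* + t * s * f j j by ring.
rewrite zs tz ts mul1r (_ : _ + f j j = f i i + f j j - 2%:R * `|z|); last by ring.
by rewrite subr_ge0.
Qed.

End Kernels.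

(** * Spectrum of a positive semidefinite matrix *)

Section PositiveMatrix.
Variables (C : numClosedFieldType) (k : nat).
Implicit Type A : 'M[C]_k.
Local Open Scope sesquilinear_scope.

Lemma char_poly_conj A (P : 'M[C]_k) :
  P \in unitmx -> char_poly (invmx P *m A *m P) = char_poly A.
Proof.
move=> uP; rewrite /char_poly /char_poly_mx.
set mC := fun M : 'M[C]_k => map_mx (@polyC C) M.
have uPC : mC P \in unitmx.
  by rewrite map_unitmx.
have -> : 'X%:M - mC (invmx P *m A *m P) = invmx (mC P) *m ('X%:M - mC A) *m mC P.
  rewrite mulmxBr mulmxBl mul_mx_scalar -scalemxAl mulVmx // scalemx1.
  by rewrite /mC !map_mxM map_invmx.
by rewrite !det_mulmx mulrAC -det_mulmx mulVmx // det1 mul1r.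
Qed.

(** A positive matrix is Hermitian, hence unitarily diagonalizable. Each eigenvalue is the value of
    the form at a unit eigenvector; trace, Hilbert-Schmidt norm and characteristic polynomial are
    unitary invariants. *)
Lemma poskernel_spectrum A : poskernel (fun i j => A i j) ->
  exists D : 'I_k -> C,
    [/\ forall i, 0 <= D i, \sum_i D i = \tr A,
        \sum_i D i ^+ 2 = \sum_i \sum_j `|A i j| ^+ 2 &
        char_poly A = \prod_i ('X - (D i)%:P)].
Proof.
move=> pA.
have hA : A^t* = A.
  by apply/matrixP => i j; rewrite !mxE (poskernel_hermitian i j pA) conjCK.
have nA : A \is normalmx by apply/normalmxP; rewrite hA.
have uP := spectral_unitarymx A; have unP := spectral_unit A.
have eA := orthomx_spectralP nA.
set P := spectralmx A in uP unP eA *; set D := spectral_diag A in eA *.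
exists (fun i => D 0 i); split.
- move=> i; have -> : D 0 i = (P *m A *m P^t*) i i.
    by rewrite eA -(invmx_unitary uP) mulmxA mulmxK // mulmxA mulmxV // mul1mx mxE eqxx.
  have -> : (P *m A *m P^t*) i i = qform (fun i j => A i j) (fun x => (P i x)^*).
    rewrite /qform exchange_big mxE; apply: eq_bigr => y _.
    rewrite !mxE mulr_suml; apply: eq_bigr => x _.
    by rewrite conjCK.
  exact: pA.
- rewrite eA mxtrace_mulC mulmxA mulmxV // mul1mx mxtrace_diag.
  by [].
- have -> : \sum_i \sum_j `|A i j| ^+ 2 = \tr (A *m A^t*).
    apply: eq_bigr => i _; rewrite mxE; apply: eq_bigr => j _.
    by rewrite !mxE normCK.
  rewrite hA {1 2}eA !mulmxA mulmxK // -!mulmxA mxtrace_mulC -!mulmxA mulmxV //.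
  rewrite mulmx1 mulmx_diag mxtrace_diag; apply: eq_bigr => i _.
  by rewrite mxE expr2.
- rewrite eA char_poly_conj // char_poly_trig ?diag_mx_is_trig //.
  by apply: eq_bigr => i _; rewrite mxE eqxx mulr1n.
Qed.

End PositiveMatrix.

(** * Phase space, additive characters and the characteristic function *)

Section PhaseSpace.
Variables (F : finFieldType) (n : nat).
Local Notation V := {ffun 'I_n -> F}.
Implicit Types (p q x y : V) (u v : (V * V)%type).

Definition dot p x : F := \sum_j p j * x j.
Definition scl (a : F) x : V := [ffun j => a * x j].

Lemma dotDl p q x : dot (p + q) x = dot p x + dot q x.
Proof. by rewrite -big_split; apply: eq_bigr => j _; rewrite ffunE mulrDl. Qed.
Lemma dotDr p x y : dot p (x + y) = dot p x + dot p y.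
Proof. by rewrite -big_split; apply: eq_bigr => j _; rewrite ffunE mulrDr. Qed.
Lemma dotNr p x : dot p (- x) = - dot p x.
Proof. by rewrite -sumrN; apply: eq_bigr => j _; rewrite ffunE mulrN. Qed.
Lemma dotBr p x y : dot p (x - y) = dot p x - dot p y.
Proof. by rewrite dotDr dotNr. Qed.
Lemma dotZl a p x : dot (scl a p) x = a * dot p x.
Proof. by rewrite mulr_sumr; apply: eq_bigr => j _; rewrite ffunE mulrA. Qed.
Lemma dotZr a p x : dot p (scl a x) = a * dot p x.
Proof. by rewrite mulr_sumr; apply: eq_bigr => j _; rewrite ffunE mulrCA. Qed.
Lemma dot0r p : dot p 0 = 0.
Proof. by rewrite /dot big1 // => j _; rewrite ffunE mulr0. Qed.

Lemma scl_bij a : a != 0 -> bijective (scl a).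
Proof.
by move=> a0; exists (scl a^-1) => x; apply/ffunP=> j; rewrite !ffunE mulrA (mulVf, divff) ?mul1r.
Qed.

Definition scl2 (a b : F) u : (V * V)%type := (scl a u.1, scl b u.2).

Lemma scl2_bij a b : a != 0 -> b != 0 -> bijective (scl2 a b).
Proof.
move=> a0 b0; exists (scl2 a^-1 b^-1) => -[x y]; congr pair; apply/ffunP=> j;
  by rewrite !ffunE mulrA (mulVf, divff) ?mul1r.
Qed.

Definition symp u v : F := dot u.1 v.2 - dot v.1 u.2.

(** Consequently diagonal dilations send isotropic sets to isotropic sets. *)
Lemma symp_scl2 a b u v : symp (scl2 a b u) (scl2 a b v) = a * b * symp u v.
Proof. by rewrite /symp !dotZl !dotZr !mulrA -mulrBr. Qed.

Variables (C : numClosedFieldType) (e : F -> C).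
Hypotheses (eD : {morph e : a b / a + b >-> a * b}) (e_norm : forall a, `|e a| = 1).
Hypothesis e_nontriv : e 1 != 1.
Implicit Types (f h : V -> V -> C) (psi : V -> C).
Local Notation D := (#|{: V}|%:R).

Lemma e_neq0 a : e a != 0.
Proof. by rewrite -normr_gt0 e_norm. Qed.
Lemma e0 : e 0 = 1.
Proof. by apply: (mulfI (e_neq0 0)); rewrite -eD addr0 mulr1. Qed.
Lemma e_conj a : (e a)^* = e (- a).
Proof.
apply: (mulfI (e_neq0 a)); rewrite -eD subrr e0 -normCK e_norm.
by rewrite expr1n.
Qed.

(** If [x != 0], some [p0] has [dot p0 x = 1]; translating the summation variable by [p0] multiplies
    the sum by [e 1 != 1], so it is 0. *)
Lemma charsum x : \sum_p e (dot p x) = D * (x == 0)%:R.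
Proof.
have [->|] := eqVneq x 0.
  under eq_bigr do rewrite dot0r e0.
  by rewrite sumr_const mulr1.
move=> /eqP x0; rewrite mulr0.
have [j xj] : exists j, x j != 0.
  apply/existsP; apply: contra_notT x0; rewrite negb_exists => /forallP x0.
  by apply/ffunP => j; rewrite ffunE; apply/eqP; have := x0 j; rewrite negbK.
pose p0 : V := [ffun k => (x j)^-1 * (k == j)%:R].
have p0x : dot p0 x = 1.
  rewrite /dot (bigD1 j) //= big1 ?addr0 => [|k /negbTE kj]; rewrite ffunE ?kj.
    by rewrite eqxx mulr1 mulVf.
  by rewrite mulr0 mul0r.
set s := \sum_p _; have : s = e 1 * s.
  rewrite [LHS](reindex_inj (addIr p0)) mulr_sumr; apply: eq_bigr => p _.
  by rewrite dotDl p0x eD mulrC.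
move/eqP; rewrite -subr_eq0 -{1}[s]mul1r -mulrBl mulf_eq0 subr_eq0 eq_sym.
by rewrite (negbTE e_nontriv) => /eqP.
Qed.

(** The trace of [Z^p X^q f] for [u = (p, q)]. The scalar phase of the Weyl operator is left out, so
    that odd [d] and [d = 2] are treated alike. *)
Definition charf f u : C := \sum_(k : V) e (dot u.1 k) * f (k - u.2) k.

Lemma sum_addr_sub (g : V -> V -> C) :
  \sum_(q : V) \sum_(k : V) g (k - q) k = \sum_x \sum_y g x y.
Proof.
rewrite exchange_big [RHS]exchange_big; apply: eq_bigr => k _.
by rewrite [RHS](reindex_inj (can_inj (subKr k))).
Qed.

(** For each fixed shift [q], expand the square and sum over [p]: orthogonality of characters leaves
    only the diagonal terms [k = l]. *)
Lemma parseval f : \sum_u `|charf f u| ^+ 2 = D * purity f.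
Proof.
rewrite -(pair_bigA _ (fun p q => `|charf f (p, q)| ^+ 2)) exchange_big /=.
rewrite /purity -(sum_addr_sub (fun x y => `|f x y| ^+ 2)) mulr_sumr.
apply: eq_bigr => q _; rewrite mulr_sumr.
have H p : `|charf f (p, q)| ^+ 2 =
    \sum_(k : V) \sum_(l : V) f (k - q) k * (f (l - q) l)^* * e (dot p (k - l)).
  rewrite normCK /charf rmorph_sum mulr_suml; apply: eq_bigr => k _ /=.
  rewrite mulr_sumr; apply: eq_bigr => l _.
  by rewrite rmorphM /= e_conj dotBr eD; ring.
under eq_bigr do rewrite H.
rewrite exchange_big; apply: eq_bigr => k _.
rewrite exchange_big (bigD1 k) //= [X in _ + X]big1 ?addr0 => [|l lk].
  by rewrite -mulr_sumr subrr charsum eqxx mulr1 normCK mulrC.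
by rewrite -mulr_sumr charsum subr_eq0 eq_sym (negbTE lk) !mulr0.
Qed.

Lemma charf0 f : charf f 0 = \sum_x f x x.
Proof.
apply: eq_bigr => x _; rewrite subr0 /dot big1 ?e0 ?mul1r // => j _.
by rewrite ffunE mul0r.
Qed.

(** After the triangle inequality, [poskernel_offdiag] bounds twice the sum by two sums of diagonal
    entries, each equal to the trace. *)
Lemma charf_le1 f u : poskernel f -> \sum_x f x x = 1 -> `|charf f u| <= 1.
Proof.
move=> pf tf; apply: le_trans (ler_norm_sum _ _ _) _.
under eq_bigr do rewrite normrM e_norm mul1r.
rewrite -(ler_pM2l (ltr0Sn C 1)) mulr_sumr.
apply: le_trans (ler_sum _ (fun k _ => poskernel_offdiag _ _ pf)) _.
rewrite big_split /= tf [X in X + _](_ : _ = 1) ?mulr1 // -tf.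
by rewrite [RHS](reindex_inj (addIr (- u.2))).
Qed.

End PhaseSpace.

(** * The convolution in coordinates *)

Section Convolution.
Variables (F : finFieldType) (n : nat).
Local Notation V := {ffun 'I_n -> F}.
Variables (g00 g01 g10 g11 : F).
Local Notation det := (g00 * g11 - g01 * g10).

(** Kernel form of [boxtimes]: the key unitary permutes basis labels by [unmixing], so conjugating
    by it evaluates the tensor product at [mixing (a, b)] and [mixing (a', b)], and the partial
    trace sums over [b]. *)
Definition box (C : pzRingType) (f h : V -> V -> C) (a a' : V) : C :=
  \sum_(b : V) f (scl g00 a + scl g10 b) (scl g00 a' + scl g10 b)
       * h (scl g01 a + scl g11 b) (scl g01 a' + scl g11 b).

Definition mixing (u : (V * V)%type) : (V * V)%type :=
  (scl g00 u.1 + scl g10 u.2, scl g01 u.1 + scl g11 u.2).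
Definition unmixing (u : (V * V)%type) : (V * V)%type :=
  (scl (det^-1 * g11) u.1 - scl (det^-1 * g10) u.2,
   - scl (det^-1 * g01) u.1 + scl (det^-1 * g00) u.2).

Hypothesis det0 : det != 0.

Lemma mixingK : cancel mixing unmixing.
Proof.
by move=> [a b]; congr pair; apply/ffunP => j; rewrite !ffunE; field.
Qed.
Lemma unmixingK : cancel unmixing mixing.
Proof.
by move=> [a b]; congr pair; apply/ffunP => j; rewrite !ffunE; field.
Qed.

Variables (C : numClosedFieldType) (e : F -> C).
Hypotheses (eD : {morph e : a b / a + b >-> a * b}).
Implicit Types (f h : V -> V -> C) (psi : V -> C).

(** Substitute [(k, l) = mixing (a, b)] in the product of the two sums. Inverting,
    [a = N g11 k - N g10 l] with [N = det^-1], which splits [e (dot p a)]; a shift of [a] by [q]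
    shifts [k] by [g00 q] and [l] by [g01 q]. *)
Lemma charf_box f h u :
  charf e (box f h) u =
  charf e f (scl2 (det^-1 * g11) g00 u) * charf e h (scl2 (- (det^-1 * g10)) g01 u).
Proof.
case: u => p q; rewrite /charf mulr_suml.
under [RHS]eq_bigr do rewrite mulr_sumr.
rewrite pair_bigA /= (reindex mixing) /=; last first.
  by exists unmixing => x _; [exact: mixingK | exact: unmixingK].
rewrite -(pair_bigA _ (fun a b : V => e (dot (scl (det^-1 * g11) p) (scl g00 a + scl g10 b)) *
  f (scl g00 a + scl g10 b - scl g00 q) (scl g00 a + scl g10 b) *
  (e (dot (scl (- (det^-1 * g10)) p) (scl g01 a + scl g11 b)) *
  h (scl g01 a + scl g11 b - scl g01 q) (scl g01 a + scl g11 b)))) /=.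
apply: eq_bigr => a _; rewrite mulr_sumr; apply: eq_bigr => b _.
have sclB c (x y z : V) : scl c (x - y) + z = scl c x + z - scl c y.
  by apply/ffunP => j; rewrite !ffunE; ring.
rewrite !sclB [RHS]mulrACA -eD; congr (e _ * _).
by rewrite !dotDr !dotZl !dotZr; field.
Qed.

Lemma poskernel_pullback (T T' : finType) (k : T' -> T' -> C) (s : T -> T') :
  bijective s -> poskernel k -> poskernel (fun x y => k (s x) (s y)).
Proof.
move=> bs pk v; case: (bs) => s' sK s'K.
suff -> : qform (fun x y => k (s x) (s y)) v = qform k (fun x => v (s' x)) by exact: pk.
rewrite /qform [RHS](reindex s) /=; last exact: onW_bij.
apply: eq_bigr => x _; rewrite [RHS](reindex s) /=; last exact: onW_bij.
by apply: eq_bigr => y _; rewrite !sK.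
Qed.

(** For each [b], the factors of [psi] can be absorbed into the test vector; what remains is the
    form of [f] pulled back along the affine bijection [a -> g00 a + g10 b]. *)
Lemma poskernel_box f psi : g00 != 0 -> poskernel f ->
  poskernel (box f (fun x y => psi x * (psi y)^*)).
Proof.
move=> g0 pf v; pose r (b a : V) : V := scl g00 a + scl g10 b.
pose w (b a : V) := v a * (psi (scl g01 a + scl g11 b))^*.
have -> : qform (box f (fun x y => psi x * (psi y)^*)) v =
    \sum_(b : V) qform (fun a a' => f (r b a) (r b a')) (w b).
  rewrite /qform /box /w /r [RHS]exchange_big; apply: eq_bigr => a _.
  rewrite [RHS]exchange_big; apply: eq_bigr => a' _.
  rewrite mulr_sumr mulr_suml; apply: eq_bigr => b _.
  by rewrite rmorphM /= conjCK; ring.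
apply: sumr_ge0 => b _; apply: poskernel_pullback => //.
have [s sK s'K] := @scl_bij F n _ g0.
exists (fun x : V => s (x - scl g10 b)) => x; rewrite /r ?addrK ?sK //.
by rewrite s'K subrK.
Qed.

(** Used to see that the maximally mixed input gives the maximally mixed output. *)
Lemma box_delta h a a' : g00 != 0 -> g11 != 0 ->
  box (fun x y => (x == y)%:R) h a a' = (a == a')%:R * \sum_x h x x.
Proof.
move=> g0 g1; rewrite /box; have [<-|aa'] := eqVneq a a'.
  rewrite mul1r [RHS](reindex (fun b : V => scl g01 a + scl g11 b)) /=.
    by apply: eq_bigr => b _; rewrite eqxx mul1r.
  have [s sK s'K] := @scl_bij F n _ g1.
  by exists (fun x : V => s (x - scl g01 a)) => x _; rewrite ?s'K addrC ?addKr ?sK ?subrK.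
rewrite mul0r big1 // => b _; rewrite (inj_eq (addIr _)).
by rewrite (bij_eq (@scl_bij F n _ g0)) (negbTE aa') mul0r.
Qed.

End Convolution.

(** * Simultaneous diagonalization of commuting unitaries *)

Section UnitaryFamily.
Local Open Scope sesquilinear_scope.
Variables (C : numClosedFieldType) (k : nat).


(** Trigonalize the family together with its adjoints in one unitary basis: a matrix that is
    triangular along with its adjoint is diagonal. *)
Lemma commuting_unitary_codiag (As : seq 'M[C]_k) :
  {in As, forall A, A \is unitarymx} -> {in As &, forall A B, A *m B = B *m A} ->
  exists2 P : 'M[C]_k, P \is unitarymx &
    {in As, forall A, is_diag_mx (P *m A *m P^t*)}.
Proof.
move=> uAs cAs.
have trCM (A B : 'M[C]_k) : (A *m B)^t* = B^t* *m A^t* by rewrite trmx_mul map_mxM.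
(* The adjoint of a unitary is its inverse, so it commutes with whatever the unitary commutes
   with. *)
have cstar : {in As &, forall A B, A *m B^t* = B^t* *m A}.
  move=> A B iA iB.
  rewrite -(invmx_unitary (uAs _ iB)); have uB := unitarymx_unit (uAs _ iB).
  rewrite -[LHS](mulKmx uB); congr (_ *m _).
  by rewrite mulmxA -(cAs _ _ iA iB) mulmxK.
have [|P uP /allP tP] := @cotrigonalization C k (As ++ [seq A^t* | A <- As]).
  move=> A B; rewrite !mem_cat => /orP[iA|/mapP[A' iA ->]] /orP[iB|/mapP[B' iB ->]].
  - exact: cAs.
  - exact: cstar.
  - by rewrite /comm_mx cstar.
  - by rewrite /comm_mx -!trCM cAs.
exists P => // A iA; have unP := unitarymx_unit uP.
have /tP : A \in As ++ [seq A^t* | A <- As] by rewrite mem_cat iA.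
have /tP : A^t* \in As ++ [seq A^t* | A <- As].
  by rewrite mem_cat; apply/orP; right; apply/mapP; exists A.
rewrite /= /mxred.similar_to !conjymx // => /is_trig_mxP t1 /is_trig_mxP t2.
apply/is_diag_mxP => i j; rewrite neq_ltn => /orP[/t2 //|/t1].
have -> : P *m A^t* *m P^t* = (P *m A *m P^t*)^t* by rewrite !trCM trmxCK mulmxA.
by rewrite !mxE => /eqP; rewrite conjC_eq0 => /eqP.
Qed.

End UnitaryFamily.

Lemma sum_enum_val (T : finType) (M : nmodType) (G : T -> M) :
  \sum_x G x = \sum_(i < #|T|) G (enum_val i).
Proof. by rewrite (reindex (@enum_val T predT)) //; exact: onW_bij (enum_val_bij _). Qed.

(** * Weyl operators acting on vectors, and their eigenvectors *)

Section Weyl.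
Local Open Scope sesquilinear_scope.
Variables (F : finFieldType) (n : nat).
Local Notation V := {ffun 'I_n -> F}.
Variables (C : numClosedFieldType) (e : F -> C).
Hypotheses (eD : {morph e : a b / a + b >-> a * b}) (e_norm : forall a, `|e a| = 1).
Hypothesis e_faithful : forall a, e a = 1 -> a = 0.
Implicit Types (p q x y : V) (u v : (V * V)%type) (f h : V -> V -> C) (psi : V -> C).
Local Notation D := (#|{: V}|%:R).
Local Notation charf := (charf e).

Lemma e1_neq1 : e 1 != 1.
Proof. by apply/eqP => /e_faithful /eqP; rewrite oner_eq0. Qed.

(** The operator [Z^p X^q] on amplitude functions, without the Weyl phase. *)
Definition act u psi x : C := e (dot u.1 x) * psi (x - u.2).
Definition proj psi x y : C := psi x * (psi y)^*.

Lemma act_add u v psi x : act u (act v psi) x = e (- dot v.1 u.2) * act (u + v) psi x.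
Proof.
rewrite /act /= !mulrA -!eD; congr (e _ * psi _); first by rewrite dotBr dotDl; ring.
by rewrite opprD addrA.
Qed.

Lemma act_comm u v psi x : act u (act v psi) x = e (symp u v) * act v (act u psi) x.
Proof.
rewrite !act_add mulrA -eD /symp (addrC v u); congr (e _ * _); ring.
Qed.

Lemma act_scale u psi c x : act u (fun y => c * psi y) x = c * act u psi x.
Proof. by rewrite /act mulrCA. Qed.

Lemma act_ext u psi psi' : psi =1 psi' -> act u psi =1 act u psi'.
Proof. by move=> eq x; rewrite /act eq. Qed.

Lemma charf_proj psi u : charf (proj psi) u = \sum_x act u psi x * (psi x)^*.
Proof. by apply: eq_bigr => x _; rewrite /proj /act mulrA. Qed.

Lemma act_norm u psi : \sum_x `|act u psi x| ^+ 2 = \sum_x `|psi x| ^+ 2.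
Proof.
rewrite [RHS](reindex_inj (addIr (- u.2))); apply: eq_bigr => x _.
by rewrite normrM e_norm mul1r.
Qed.

Lemma proj_trace psi : \sum_x proj psi x x = \sum_x `|psi x| ^+ 2.
Proof. by apply: eq_bigr => x _; rewrite normCK. Qed.

Lemma poskernel_proj psi : poskernel (proj psi).
Proof.
move=> v; have -> : qform (proj psi) v = `|\sum_x (v x)^* * psi x| ^+ 2.
  rewrite normCK rmorph_sum mulr_suml; apply: eq_bigr => x _.
  rewrite mulr_sumr; apply: eq_bigr => y _.
  by rewrite rmorphM /= conjCK /proj; ring.
exact: exprn_ge0.
Qed.

Lemma purity_proj psi : purity (proj psi) = (\sum_x `|psi x| ^+ 2) ^+ 2.
Proof.
rewrite expr2 mulr_suml; apply: eq_bigr => x _; rewrite mulr_sumr.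
by apply: eq_bigr => y _; rewrite normrM norm_conjC exprMn.
Qed.

Definition eigen u psi := exists c, forall x, act u psi x = c * psi x.

Section Unit.
Variable psi : V -> C.
Hypothesis psi1 : \sum_x `|psi x| ^+ 2 = 1.

Lemma psi_neq0 : exists x, psi x != 0.
Proof.
have [/existsP //|] := boolP [exists x, psi x != 0].
rewrite negb_exists => /forallP p0; move/eqP: psi1.
rewrite big1 => [|x _]; first by rewrite eq_sym oner_eq0.
by have := p0 x; rewrite negbK => /eqP->; rewrite normr0 expr0n.
Qed.

Lemma eigen_norm u c : (forall x, act u psi x = c * psi x) -> `|c| = 1.
Proof.
move=> h; have := act_norm u psi; rewrite psi1.
under eq_bigr do rewrite h normrM exprMn.
by rewrite -mulr_sumr psi1 mulr1 => /eqP; rewrite pexpr_eq1 // => /eqP.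
Qed.

(** Equality case of Cauchy-Schwarz: with [c] the overlap of [act u psi] and [psi], the squared norm
    of [act u psi - c psi] is [1 - |c|^2]. *)
Lemma charf_eigen u : `|charf (proj psi) u| = 1 <-> eigen u psi.
Proof.
split=> [c1|[c h]]; last first.
  rewrite charf_proj; under eq_bigr do rewrite h -mulrA -normCK.
  by rewrite -mulr_sumr psi1 mulr1 (eigen_norm h).
set c := charf _ u in c1; exists c.
have : \sum_x `|act u psi x - c * psi x| ^+ 2 == 0.
  have -> : \sum_x `|act u psi x - c * psi x| ^+ 2 =
    \sum_x (`|act u psi x| ^+ 2 - act u psi x * (psi x)^* * c^*
            - c * (act u psi x * (psi x)^*)^* + c * c^* * `|psi x| ^+ 2).
    apply: eq_bigr => x _; rewrite !normCK !(rmorphB, rmorphM) /= conjCK; ring.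
  rewrite big_split /= !sumrB -mulr_suml -!mulr_sumr -rmorph_sum -charf_proj -/c.
  by rewrite act_norm psi1 -normCK c1 expr1n; apply/eqP; ring.
rewrite psumr_eq0 => [/allP h x|x _]; last exact: exprn_ge0.
have := h x (mem_index_enum _); rewrite /= sqrf_eq0 normr_eq0 subr_eq0.
by move/eqP.
Qed.

Lemma eigen0 : eigen 0 psi.
Proof.
exists 1 => x; rewrite /act /= subr0 mul1r /dot big1 ?(e0 eD e_norm) ?mul1r // => j _.
by rewrite ffunE mul0r.
Qed.

Lemma eigenD u v : eigen u psi -> eigen v psi -> eigen (u + v) psi.
Proof.
move=> [c hc] [c' hc']; exists (e (dot v.1 u.2) * c' * c) => x.
have : act u (act v psi) x = c' * (c * psi x).
  by rewrite -hc -act_scale; exact: act_ext.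
rewrite act_add -!mulrA => <-.
by rewrite mulrA -eD subrr (e0 eD e_norm) mul1r.
Qed.

(** On a common eigenvector the two operators commute, so the commutation factor [e (symp u v)] is
    1; faithfulness of [e] concludes. *)
Lemma eigen_symp0 u v : eigen u psi -> eigen v psi -> symp u v = 0.
Proof.
move=> [c hc] [c' hc']; apply: e_faithful; have [x x0] := psi_neq0.
have H : act u (act v psi) x = c' * (c * psi x) by rewrite -hc -act_scale; exact: act_ext.
have H' : act v (act u psi) x = c * (c' * psi x) by rewrite -hc' -act_scale; exact: act_ext.
have := act_comm u v psi x; rewrite H H' mulrCA -[LHS]mul1r => /esym /mulIf; apply.
by rewrite !mulf_neq0 // -normr_gt0 ?(eigen_norm hc) ?(eigen_norm hc').
Qed.

End Unit.

(** The matrices [W u] of [act u] are unitary and commute on an isotropic set, so one unitary [P]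
    diagonalizes them all. The vectors are the columns of its adjoint; [P P^* = 1] normalizes them
    and [P^* P = 1] resolves the identity. *)
Lemma common_eigenbasis (S : {set (V * V)%type}) :
  {in S &, forall u v, symp u v = 0} ->
  exists phi : 'I_#|{: V}| -> V -> C,
    [/\ forall i, \sum_x `|phi i x| ^+ 2 = 1,
        forall x y, \sum_i proj (phi i) x y = (x == y)%:R &
        forall i, {in S, forall u, eigen u (phi i)}].
Proof.
move=> iS.
pose W u : 'M[C]_#|{: V}| :=
  \matrix_(i, j) (e (dot u.1 (enum_val i)) * (enum_val j == enum_val i - u.2)%:R).
have WM u k (A : 'M[C]_(_, k)) i j : (W u *m A) i j =
    e (dot u.1 (enum_val i)) * A (enum_rank (enum_val i - u.2)) j.
  rewrite mxE (bigD1 (enum_rank (enum_val i - u.2))) //= big1 => [|l nl].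
    by rewrite mxE enum_rankK eqxx mulr1 addr0.
  rewrite mxE (negbTE (_ : enum_val l != _)) ?mulr0 ?mul0r //.
  by apply: contra nl => /eqP<-; rewrite enum_valK.
have uW u : W u \is unitarymx.
  apply/unitarymxP/matrixP => i j; rewrite WM !mxE enum_rankK.
  rewrite (inj_eq (addIr _)) (inj_eq enum_val_inj).
  have [->|] := eqVneq i j; last by rewrite mulr0 conjC0 mulr0.
  by rewrite mulr1 -normCK e_norm expr1n.
have cW : {in [seq W u | u in S] &, forall A B, A *m B = B *m A}.
  move=> _ _ /mapP[u + ->] /mapP[v + ->]; rewrite !mem_enum => uS vS.
  apply/matrixP => i j; rewrite !WM !mxE !enum_rankK !mulrA -!eD.
  rewrite (addrAC (enum_val i)); congr (e _ * _).
  have /eqP := iS _ _ uS vS; rewrite /symp subr_eq0 !dotBr => /eqP->.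
  by ring.
have [|P uP dP] := commuting_unitary_codiag _ cW.
  by move=> _ /mapP[u _ ->].
have /unitarymxP PP := uP.
have P'P : P^t* *m P = 1%:M by rewrite (mulmx1C PP).
exists (fun i x => (P i (enum_rank x))^*); split.
- move=> i; have /matrixP/(_ i i) := PP; rewrite !mxE eqxx /= mulr1n => <-.
  rewrite sum_enum_val.
  by apply: eq_bigr => j _; rewrite !mxE enum_valK norm_conjC normCK.
- move=> x y; have /matrixP/(_ (enum_rank x) (enum_rank y)) := P'P.
  rewrite !mxE (inj_eq enum_rank_inj) => <-.
  by apply: eq_bigr => j _; rewrite !mxE /proj conjCK.
- move=> i u uS; have /dP dW : W u \in [seq W u | u in S] by apply/mapP; exists u; rewrite ?mem_enum.
  have : W u *m P^t* = P^t* *m (P *m W u *m P^t*) by rewrite !mulmxA P'P mul1mx.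
  move: (P *m W u *m P^t*) dW => M dM /matrixP WP; exists (M i i) => x.
  have := WP (enum_rank x) i; rewrite WM !enum_rankK !mxE /act => ->; rewrite (bigD1 i) //= big1 ?addr0 => [|j ji].
    by rewrite !mxE mulrC.
  by rewrite (is_diag_mxP dM) ?mulr0 // eq_sym.
Qed.

End Weyl.

(** * Nearly pure outputs and stabilizer vectors *)

Section PureOutputs.
Variables (F : finFieldType) (n : nat).
Local Notation V := {ffun 'I_n -> F}.
Variables (C : numClosedFieldType) (e : F -> C).
Hypotheses (eD : {morph e : a b / a + b >-> a * b}) (e_norm : forall a, `|e a| = 1).
Hypothesis e_faithful : forall a, e a = 1 -> a = 0.
Variables (g00 g01 g10 g11 : F).
Hypotheses (g00_0 : g00 != 0) (g01_0 : g01 != 0) (g10_0 : g10 != 0) (g11_0 : g11 != 0).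
Hypothesis det0 : g00 * g11 - g01 * g10 != 0.
Variable psi : V -> C.
Hypothesis psi1 : \sum_x `|psi x| ^+ 2 = 1.
Implicit Types (u v : (V * V)%type) (f : V -> V -> C).
Local Notation D := (#|{: V}|%:R).
Local Notation charf := (charf e).
Local Notation h := (proj psi).
Local Notation box := (box g00 g01 g10 g11).
Local Notation N := (g00 * g11 - g01 * g10)^-1.
Local Notation eigen := (eigen e).
Let A : (V * V)%type -> (V * V)%type := scl2 (N * g11) g00.
Let B : (V * V)%type -> (V * V)%type := scl2 (- (N * g10)) g01.

Let bijA : bijective A.
Proof. by apply: scl2_bij => //; rewrite mulf_neq0 ?invr_neq0. Qed.
Let bijB : bijective B.
Proof. by apply: scl2_bij => //; rewrite oppr_eq0 mulf_neq0 ?invr_neq0. Qed.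

Let e1 : e 1 != 1 := e1_neq1 e_faithful.

Let charf_h_le1 u : `|charf h u| ^+ 2 <= 1.
Proof.
by rewrite expr_le1 // charf_le1 // ?proj_trace //; exact: poskernel_proj.
Qed.

Lemma charf_gap f (eps : C) u : poskernel f -> \sum_x f x x = 1 -> purity f <= 1 ->
  1 - eps <= purity (box f h) ->
  `|charf h u| ^+ 2 * (1 - `|charf h u| ^+ 2) <= 2%:R * D * eps.
Proof.
(* As [B] is onto, it suffices to bound at points [B u], which match the factors of [charf_box]. *)
move=> pf tf puf hE; case: (bijB) => B' BK B'K; rewrite -(B'K u); move: (B' u) => {}u.
pose a v := `|charf f (A v)| ^+ 2; pose b v := `|charf h (B v)| ^+ 2.
have a01 v : 0 <= a v <= 1 by rewrite exprn_ge0 //= expr_le1 // charf_le1.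
have b01 v : 0 <= b v <= 1 by rewrite exprn_ge0 //= charf_h_le1.
have D0 : 0 <= D :> C by rewrite ler0n.
have Sa : \sum_v a v <= D.
  rewrite (_ : \sum_v a v = D * purity f) ?ler_piMr //.
  by rewrite -(parseval eD e_norm e1 f) [RHS](reindex A) //; exact: onW_bij.
have Sb : \sum_v b v = D.
  have ph : purity h = 1 by rewrite purity_proj psi1 expr1n.
  transitivity (D * purity h); last by rewrite ph mulr1.
  by have := parseval eD e_norm e1 h; rewrite (reindex B) => [<- //|]; exact: onW_bij.
have Sab : D * (1 - eps) <= \sum_v a v * b v.
  rewrite (_ : \sum_v _ = D * purity (box f h)) ?ler_wpM2l //.
  rewrite -(parseval eD e_norm e1 (box f h)); apply: eq_bigr => v _.
  by rewrite charf_box // normrM exprMn.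
have term v : b v * (1 - b v) <= a v * (1 - b v) + b v * (1 - a v).
  have [/andP[a0 a1] /andP[b0 b1]] := (a01 v, b01 v).
  (* Split [b (1 - b)] with weights [a] and [1 - a], then drop one factor at most 1 from each
     summand. *)
  have -> : b v * (1 - b v) = a v * (b v * (1 - b v)) + b v * ((1 - a v) * (1 - b v)) by ring.
  by apply: lerD; apply: ler_wpM2l => //; rewrite ?ler_piMl ?ler_piMr ?subr_ge0 // lerBlDr lerDl.
apply: le_trans (term u) _.
apply: (@le_trans _ _ (\sum_v (a v * (1 - b v) + b v * (1 - a v)))).
  rewrite [leRHS](bigD1 u) //= lerDl; apply: sumr_ge0 => v _.
  have [/andP[a0 a1] /andP[b0 b1]] := (a01 v, b01 v).
  by rewrite addr_ge0 // mulr_ge0 // subr_ge0.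
have -> : \sum_v (a v * (1 - b v) + b v * (1 - a v)) =
    \sum_v a v + \sum_v b v - 2%:R * \sum_v a v * b v.
  rewrite mulr_sumr -big_split -sumrB; apply: eq_bigr => v _ /=; ring.
have -> : 2%:R * D * eps = D + D - 2%:R * (D * (1 - eps)) by ring.
by rewrite Sb lerB ?lerD2r // ler_wpM2l.
Qed.

Lemma stabilizer_of_almost_pure :
  (forall eps : C, 0 < eps -> exists f, [/\ poskernel f, \sum_x f x x = 1,
     purity f <= 1 & 1 - eps <= purity (box f h)]) ->
  exists S : {set (V * V)%type}, #|S| = #|{: V}| /\ forall u, u \in S <-> eigen u psi.
Proof.
move=> H; pose b u := `|charf h u| ^+ 2.
have D0 : 0 < D :> C by rewrite ltr0n; apply/card_gt0P; exists 0.
have b01 u : 0 <= b u * (1 - b u) by rewrite mulr_ge0 ?exprn_ge0 // subr_ge0 charf_h_le1.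
have bb u : b u * (1 - b u) = 0.
  apply/eqP; rewrite eq_le b01 andbT -[_ <= 0]negbK -real_ltNge ?ger0_real ?b01 //.
  apply/negP => bu.
  (* With this [eps] the bound of [charf_gap] is half of [b u * (1 - b u)], a contradiction if that
     is positive. *)
  have [|f [pf tf puf hE]] := H (b u * (1 - b u) / (4%:R * D)).
    by rewrite divr_gt0 // mulr_gt0 // ltr0n.
  have := charf_gap u pf tf puf hE; rewrite -/(b u).
  have -> : 2%:R * D * (b u * (1 - b u) / (4%:R * D)) = (b u * (1 - b u)) / 2%:R.
    by field; rewrite gt_eqF // ltr0n.
  by rewrite ler_pdivlMr ?ltr0n // mulr_natr mulr2n gerDl => /le_gtF; rewrite bu.
exists [set u | `|charf h u| == 1]; split; last first.
  by move=> u; rewrite inE -(charf_eigen e_norm psi1); split => /eqP.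
(* The values [b u] are 0 or 1, so the Parseval sum counts the labels where [|charf h u| = 1]. *)
have := parseval eD e_norm e1 h; rewrite purity_proj psi1 expr1n mulr1.
have b1 u : b u = (`|charf h u| == 1)%:R.
  have /eqP := bb u; rewrite mulf_eq0 subr_eq0 /b => /orP[|/eqP/esym b1].
    by rewrite sqrf_eq0 => /eqP ->; rewrite expr0n [0 == 1]eq_sym oner_eq0.
  by rewrite b1; move/eqP: b1; rewrite pexpr_eq1 // => ->.
under eq_bigr do rewrite -/(b _) b1.
rewrite -natr_sum => /eqP; rewrite eqr_nat => /eqP <-.
by rewrite -sum1_card big_mkcond; apply: eq_bigr => u _; rewrite inE; case: eqP.
Qed.

(** In the Parseval sum of the output, the labels in [B @^-1: S] alone contribute [D]: there both
    factors of [charf_box] have modulus 1, provided the input is an eigenvector for the labels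
    [A u]. *)
Lemma pure_outputs (S : {set (V * V)%type}) :
  #|S| = #|{: V}| -> {in S, forall u, eigen u psi} ->
  exists phi : 'I_#|{: V}| -> V -> C,
    [/\ forall i, \sum_x `|phi i x| ^+ 2 = 1,
        forall x y, \sum_i proj (phi i) x y = (x == y)%:R &
        forall i, 1 <= purity (box (proj (phi i)) h)].
Proof.
move=> cS eS; pose T := B @^-1: S.
have [|phi [phi1 phib phiT]] := common_eigenbasis eD e_norm (S := A @: T) _.
  move=> _ _ /imsetP[u uT ->] /imsetP[v vT ->].
  move: uT vT; rewrite !inE => /eS uB /eS vB.
  have := eigen_symp0 eD e_norm e_faithful psi1 uB vB.
  (* The factor by which [B] scales [symp] is nonzero, so [symp u v = 0], and then the dilation by
     [A] keeps it 0. *)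
  rewrite /A /B !symp_scl2 => /eqP; rewrite !mulf_eq0 oppr_eq0 mulf_eq0 invr_eq0.
  by rewrite (negbTE det0) (negbTE g10_0) (negbTE g01_0) /= => /eqP->; rewrite mulr0.
exists phi; split=> // i.
have D0 : 0 < D :> C by rewrite ltr0n; apply/card_gt0P; exists 0.
rewrite -(ler_pM2l D0) -(parseval eD e_norm e1 (box _ h)) mulr1.
have -> : D = \sum_(u in T) 1 :> C.
  by rewrite sumr_const -cS; congr _%:R; rewrite /T on_card_preimset //; exact: onW_bij.
rewrite [leRHS](bigID (mem T)) /= -[leLHS]addr0 lerD //; last by apply: sumr_ge0 => u _; exact: exprn_ge0.
apply: ler_sum => u uT; rewrite charf_box // normrM.
have -> : `|charf (proj (phi i)) (A u)| = 1.
  by apply/(charf_eigen e_norm (phi1 i))/phiT/imset_f.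
have -> : `|charf h (B u)| = 1.
  by apply/(charf_eigen e_norm psi1)/eS; move: uT; rewrite inE.
by rewrite mulr1 expr1n.
Qed.

End PureOutputs.

(** * From matrices to kernels; von Neumann entropy of density operators *)

Section Translation.
Variable R : realType.
Local Notation C := R[i].
Implicit Type T : finType.

Lemma ent_mxF T (f : T -> T -> C) x y : ent (mxF f) x y = f x y.
Proof. by rewrite /ent mxE !enum_rankK. Qed.

Lemma ent_sum T (I : finType) (c : I -> C) (A : I -> Op R T) x y :
  ent (\sum_i c i *: A i) x y = \sum_i c i * ent (A i) x y.
Proof. by rewrite /ent summxE; apply: eq_bigr => i _; rewrite mxE. Qed.

Lemma entM T (A B : Op R T) x y : ent (A *m B) x y = \sum_z ent A x z * ent B z y.
Proof.
rewrite {1}/ent mxE [RHS]sum_enum_val; apply: eq_bigr => i _.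
by rewrite /ent enum_valK.
Qed.

Lemma trace_ent T (A : Op R T) : \tr A = \sum_x ent A x x.
Proof. by rewrite [RHS]sum_enum_val; apply: eq_bigr => i _; rewrite /ent enum_valK. Qed.

Lemma qform_ent T (A : Op R T) (v : 'cV[C]_#|T|) :
  (adjmx v *m A *m v) 0 0 = qform (ent A) (fun x => v (enum_rank x) 0).
Proof.
rewrite mxE /qform exchange_big [RHS]sum_enum_val; apply: eq_bigr => j _.
rewrite mxE mulr_suml [RHS]sum_enum_val; apply: eq_bigr => i _.
by rewrite mxE /ent !enum_valK.
Qed.

Lemma is_densityE T (A : Op R T) :
  is_density A <-> poskernel (ent A) /\ \sum_x ent A x x = 1.
Proof.
rewrite /is_density trace_ent; split=> -[pA tA]; split=> // v; last first.
  by rewrite qform_ent.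
have := pA (\col_i v (enum_val i)); rewrite qform_ent.
rewrite (_ : qform _ _ = qform (ent A) v) //.
rewrite /qform; apply: eq_bigr => x _; apply: eq_bigr => y _.
by rewrite !mxE !enum_rankK.
Qed.

(** [spectrum] is a chosen list of roots; one exists because the field is algebraically closed and
    the characteristic polynomial is monic. *)
Lemma spectrumP k (A : 'M[C]_k) : char_poly A = \prod_(x <- spectrum A) ('X - x%:P).
Proof.
rewrite /spectrum; set P := [set s | _]%classic.
suff : P (xget [::] P) by [].
apply: xgetPex; have [r hr] := closed_field_poly_normal (char_poly A).
exists r; rewrite /P /= {1}hr (eqP (char_poly_monic A)).
by rewrite scale1r.
Qed.

(** Unique factorization makes the chosen [spectrum] a permutation of the eigenvalues of
    [poskernel_spectrum], so the entropy is the Shannon entropy of a genuine real distribution. *)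
Lemma density_entropy T (A : Op R T) : is_density A ->
  exists l : 'I_#|T| -> R,
    [/\ forall i, 0 <= l i, \sum_i l i = 1, (\sum_i l i ^+ 2)%:C%C = purity (ent A) &
        vN_entropy A = - \sum_i (l i * ln (l i))].
Proof.
move=> /is_densityE [pA tA].
have pA' : poskernel (fun i j => A i j).
  move=> v; have := pA (fun x => v (enum_rank x)); rewrite (_ : qform _ _ = qform (fun i j => A i j) v) //.
  rewrite /qform [LHS]sum_enum_val; apply: eq_bigr => i _.
  by rewrite [LHS]sum_enum_val; apply: eq_bigr => j _; rewrite /ent !enum_valK.
have [D [D0 Dtr Dsq Dchar]] := poskernel_spectrum pA'.
have DR i : D i = (complex.Re (D i))%:C%C by rewrite RRe_real // ger0_real.
exists (fun i => complex.Re (D i)); split.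
- by move=> i; have := D0 i; rewrite {1}DR ler0c.
- apply: (@complexI R); rewrite rmorph_sum rmorph1 -tA -trace_ent -Dtr.
  by apply: eq_bigr => i _ /=; rewrite -DR.
- rewrite rmorph_sum; transitivity (\sum_i D i ^+ 2).
    by apply: eq_bigr => i _; rewrite rmorphXn /= -DR.
  rewrite Dsq /purity [RHS]sum_enum_val; apply: eq_bigr => i _.
  by rewrite [RHS]sum_enum_val; apply: eq_bigr => j _; rewrite /ent !enum_valK.
- rewrite /vN_entropy; congr (- _).
  have : perm_eq (spectrum A) [seq D i | i : 'I_#|T|].
    by apply: prod_XsubC_eq; rewrite -spectrumP Dchar big_map enumT.
  by move=> sD; rewrite (perm_big _ sD) /= big_map enumT.
Qed.

Lemma density_purity_le1 T (A : Op R T) : is_density A -> purity (ent A) <= 1.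
Proof. by move=> /density_entropy [l [l0 l1 <- _]]; rewrite lecR sum_sq_le1. Qed.

Lemma entropy_le T (A : Op R T) : is_density A -> vN_entropy A <= ln (#|T|%:R : R).
Proof. by move=> /density_entropy [l [l0 l1 _ ->]]; exact: shannon_le_ln. Qed.

Lemma entropy_ge_linear T (A : Op R T) :
  is_density A -> 1 - (vN_entropy A)%:C%C <= purity (ent A).
Proof.
move=> /density_entropy [l [l0 l1 <- ->]].
by rewrite -(rmorph1 (real_complex R)) -rmorphB lecR /= lerBlDr -lerBlDl shannon_ge_linear.
Qed.

Lemma entropy_ge0 T (A : Op R T) : is_density A -> 0 <= vN_entropy A.
Proof.
move=> /density_entropy [l [l0 l1 _ ->]]; apply: le_trans (shannon_ge_linear l0 l1).
by rewrite subr_ge0 sum_sq_le1.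
Qed.

Lemma entropy_pure T (A : Op R T) : is_density A -> 1 <= purity (ent A) -> vN_entropy A = 0.
Proof.
move=> /density_entropy [l [l0 l1 <- ->]]; rewrite lecR => P1.
by apply: shannon_eq0 => //; apply/eqP; rewrite eq_le P1 sum_sq_le1.
Qed.

Lemma entropy_ge_ln T (A : Op R T) (c : R) :
  is_density A -> purity (ent A) = c%:C%C -> - ln c <= vN_entropy A.
Proof.
by move=> /density_entropy [l [l0 l1 <- ->]] /complexI <-; exact: shannon_ge_lnsq.
Qed.

Lemma is_density_mix T (I : finType) (p : I -> R) (A : I -> Op R T) :
  (forall i, 0 <= p i) -> \sum_i p i = 1 -> (forall i, is_density (A i)) ->
  is_density (\sum_i (p i)%:C%C *: A i).
Proof.
move=> p0 p1 dA; apply/is_densityE; split.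
  move=> v; rewrite (_ : qform _ v = \sum_i (p i)%:C%C * qform (ent (A i)) v).
    apply: sumr_ge0 => i _; apply: mulr_ge0; first by rewrite ler0c.
    by have /is_densityE [] := dA i.
  rewrite /qform; under [RHS]eq_bigr do rewrite mulr_sumr.
  rewrite [RHS]exchange_big; apply: eq_bigr => x _.
  under [RHS]eq_bigr do rewrite mulr_sumr.
  rewrite [RHS]exchange_big; apply: eq_bigr => y _.
  rewrite ent_sum mulr_sumr mulr_suml; apply: eq_bigr => i _.
  by rewrite [in RHS]mulrA; congr (_ * _); rewrite mulrCA.
under eq_bigr do rewrite ent_sum.
rewrite exchange_big -(rmorph1 (real_complex R)) -p1 rmorph_sum; apply: eq_bigr => i _.
by have /is_densityE [_ tA] := dA i; rewrite -mulr_sumr tA mulr1.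
Qed.

End Translation.

Lemma det_mx2 (K : comNzRingType) (M : 'M[K]_2) :
  \det M = M 0 0 * M 1 1 - M 0 1 * M 1 0.
Proof.
rewrite (expand_det_row _ 0) !big_ord_recl big_ord0 addr0 /cofactor !det_mx11 !mxE /=.
rewrite !expr0 expr1 mul1r mulN1r mulrN.
have -> : lift 0 0 = 1 :> 'I_2 by apply/val_inj.
have -> : lift 1 0 = 0 :> 'I_2 by apply/val_inj.
by [].
Qed.

(** * The concrete character [chi], the Weyl operators and the key unitary *)

Section Root.
Variables (R : realType) (d : nat).
Hypothesis pd : prime d.
Local Notation omega := (omega R d).

Lemma omegaX k : omega ^+ k =
  (cos ((2 * pi / d%:R) *+ k) +i* sin ((2 * pi / d%:R) *+ k))%C :> R[i].
Proof.
elim: k => [|k IH]; first by rewrite expr0 mulr0n cos0 sin0.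
rewrite exprSr IH !(mulrSr (2 * pi / d%:R) k) cosD sinD; apply/eqP.
by rewrite eq_complex /= eqxx /=; apply/eqP; rewrite addrC mulrC [X in _ + X]mulrC.
Qed.

Lemma norm_omega : `|omega| = 1.
Proof. by rewrite normc_def /= cos2Dsin2 sqrtr1. Qed.

Lemma omega_order : omega ^+ d = 1.
Proof.
rewrite omegaX -mulr_natr mulfVK ?pnatr_eq0 -?lt0n ?prime_gt0 // mulrC mulr_natr.
by rewrite cos_mulr2n sin_mulr2n cospi sinpi sqrrN expr1n mulr0 mul0rn mulr2n addrK.
Qed.

(** By the double-angle formula, real part 1 would force [sin (pi / d) = 0], but [0 < pi / d < pi]
    since [d > 1]. *)
Lemma omega_neq1 : omega != 1.
Proof.
apply/eqP => /(congr1 (@complex.Re R)) /=.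
have d_gt0 : 0 < d%:R :> R by rewrite ltr0n prime_gt0.
have -> : 2 * pi / d%:R = (pi / d%:R) *+ 2 :> R by rewrite -mulrA mulr_natl.
rewrite cos_mulr2n => c1.
have : 0 < sin (pi / d%:R) ^+ 2 :> R.
  rewrite exprn_gt0 // sin_gt0_pi // divr_gt0 ?pi_gt0 //=.
  by rewrite ltr_pdivrMr // ltr_pMr ?pi_gt0 // ltr1n prime_gt1.
have := cos2Dsin2 (pi / d%:R : R); move: c1; rewrite mulr2n.
by lra.
Qed.

Lemma omega_primitive : d.-primitive_root omega.
Proof.
have [m m_prim mdvd] := prim_order_exists (prime_gt0 pd) omega_order.
have /primeP[_ /(_ _ mdvd)/orP[]/eqP md] := pd; last by rewrite md in m_prim.
by move: (prim_expr_order m_prim); rewrite md expr1 => /eqP; rewrite (negbTE omega_neq1).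
Qed.

Local Notation chi := (@chi R d).

Lemma chiD : {morph chi : a b / a + b >-> a * b}.
Proof.
move=> a b; rewrite /chi -exprD -[RHS](expr_mod _ omega_order); congr (_ ^+ _).
(* Addition in ['F_d] is modulo a number that equals [d] only through primality. *)
by rewrite -[X in (_ %% X)%N](Fp_cast pd).
Qed.

Lemma norm_chi a : `|chi a| = 1.
Proof. by rewrite normrX norm_omega expr1n. Qed.

Lemma chi_faithful a : chi a = 1 -> a = 0.
Proof.
move=> /eqP; rewrite -(prim_order_dvd omega_primitive) => da.
apply/val_inj => /=; have lt_ad : (a < d)%N by rewrite -[X in (_ < X)%N](Fp_cast pd).
by apply/eqP; move: da; rewrite /dvdn modn_small.
Qed.

(** Isolates the unit scalar by which [weyl u] differs from [act chi u]; eigenvectors and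
    commutation do not depend on it. *)
Definition phase n (u : (Idx d n * Idx d n)%type) : R[i] :=
  \prod_(j < n) weyl_phase R (u.1 j) (u.2 j).

Lemma norm_phase n (u : (Idx d n * Idx d n)%type) : `|phase u| = 1.
Proof.
rewrite normr_prod big1 // => j _; rewrite /weyl_phase; case: ifP => _.
  rewrite normrV ?unitfE ?expf_neq0 ?neq0Ci // normrX.
  rewrite (_ : `|'i| = 1) ?expr1n ?invr1 //.
  exact: normCi.
exact: norm_chi.
Qed.

Lemma ent_weyl n (u : (Idx d n * Idx d n)%type) x y :
  ent (weyl R u) x y = phase u * (chi (dot u.1 x) * (y == x - u.2)%:R).
Proof.
rewrite ent_mxF /weyl1 big_split /=; congr (_ * _).
have [->|/eqP yx] := eqVneq y (x - u.2).
  rewrite mulr1 /dot (big_morph chi chiD (e0 chiD norm_chi)).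
  by apply: eq_bigr => j _; rewrite !ffunE /= subrK eqxx.
rewrite mulr0; apply/eqP/prodf_eq0.
have [/existsP [j jP]|] := boolP [exists j, x j != y j + u.2 j].
  by exists j => //; rewrite (negbTE jP).
rewrite negb_exists => /forallP xy; case: yx; apply/ffunP => j.
by have := xy j; rewrite negbK !ffunE => /eqP ->; rewrite addrK.
Qed.

Lemma weylM n (u : (Idx d n * Idx d n)%type) k (A : 'M[R[i]]_(#|Idx d n|, k)) i j :
  (weyl R u *m A) i j = phase u * act chi u (fun x => A (enum_rank x) j) (enum_val i).
Proof.
rewrite mxE (bigD1 (enum_rank (enum_val i - u.2))) //= big1 => [|l nl].
  by have := ent_weyl u (enum_val i) (enum_val i - u.2); rewrite /ent enum_valK => ->;
     rewrite eqxx mulr1 addr0 -mulrA.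
have := ent_weyl u (enum_val i) (enum_val l); rewrite /ent !enum_valK => ->.
rewrite (negbTE (_ : enum_val l != _)) ?mulr0 ?mul0r //.
by apply: contra nl => /eqP<-; rewrite enum_valK.
Qed.

Lemma weyl_eigen n (u : (Idx d n * Idx d n)%type) (psi : 'cV[R[i]]_#|Idx d n|) :
  (exists c, weyl R u *m psi = c *: psi) <->
  eigen chi u (fun x => psi (enum_rank x) 0).
Proof.
have ph0 : phase u != 0 by rewrite -normr_gt0 norm_phase.
split=> [[c /colP hc]|[c hc]].
  exists ((phase u)^-1 * c) => x; have := hc (enum_rank x).
  rewrite weylM enum_rankK mxE => h; apply: (mulfI ph0).
  by rewrite h -mulrA mulVKf.
exists (phase u * c); apply/colP => i.
by rewrite weylM hc mxE enum_valK mulrA.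
Qed.

Lemma weyl_comm n (u v : (Idx d n * Idx d n)%type) :
  symp u v = 0 -> weyl R u *m weyl R v = weyl R v *m weyl R u.
Proof.
(* The trailing identity matrix lets [weylM] apply to both factors. *)
move=> uv; rewrite -[weyl R v in LHS]mulmx1 -[weyl R u in RHS]mulmx1.
apply/matrixP => i j; rewrite !weylM.
have E (a b : (Idx d n * Idx d n)%type) y : act chi a (fun x => (weyl R b *m 1%:M) (enum_rank x) j) y =
    phase b * act chi a (act chi b (fun x => 1%:M (enum_rank x) j)) y.
  by rewrite -act_scale; apply: act_ext => x; rewrite weylM enum_rankK.
by rewrite !E (act_comm chiD) uv (e0 chiD norm_chi) mul1r mulrCA.
Qed.

(** The key unitary is a permutation matrix whose row [z] has its only 1 in column [mixing z], so
    each matrix product collapses to one term. *)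
Lemma ent_boxtimes n (G : 'M['F_d]_2) (rho sigma : Op R (Idx d n)) x y :
  \det G != 0 ->
  ent (boxtimes G rho sigma) x y =
    box (G 0 0) (G 0 1) (G 1 0) (G 1 1) (ent rho) (ent sigma) x y.
Proof.
rewrite det_mx2 => det0; rewrite ent_mxF; apply: eq_bigr => b _.
have km u : key_map G u = unmixing (G 0 0) (G 0 1) (G 1 0) (G 1 1) u.
  rewrite /key_map det_mx2 /unmixing; congr pair; apply/ffunP => k; rewrite !ffunE //.
  by rewrite mulNr.
have UE (z z' : (Idx d n * Idx d n)%type) : ent (key_unitary R n G) z z' =
    (z' == mixing (G 0 0) (G 0 1) (G 1 0) (G 1 1) z)%:R.
  rewrite ent_mxF km -(inj_eq (can_inj (mixingK det0))) unmixingK // eq_sym.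
  by case: eqP.
rewrite entM (bigD1 (mixing (G 0 0) (G 0 1) (G 1 0) (G 1 1) (y, b))) //=.
rewrite [X in _ + X]big1 ?addr0 => [|z /negbTE zb]; last first.
  by rewrite [X in _ * X]/ent mxE -/(ent _ _ _) UE zb conjc0 mulr0.
rewrite [X in _ * X]/ent mxE -/(ent _ _ _) UE eqxx conjc1 mulr1.
rewrite entM (bigD1 (mixing (G 0 0) (G 0 1) (G 1 0) (G 1 1) (x, b))) //=.
rewrite [X in _ + X]big1 ?addr0 => [|z /negbTE zb]; last by rewrite UE zb mul0r.
by rewrite UE eqxx mul1r ent_mxF.
Qed.

End Root.

(** * The Holevo capacity and both implications *)

Section Capacity.
Variables (R : realType) (d n : nat) (G : 'M['F_d]_2) (psi : 'cV[R[i]]_#|Idx d n|).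
Hypotheses (pd : prime d) (n_gt0 : (0 < n)%N).
Hypotheses (G0 : forall a b, G a b != 0) (det0 : \det G != 0).
Hypothesis psi1 : (adjmx psi *m psi) 0 0 = 1.
Local Notation T := (Idx d n).
Local Notation E := (fun rho : Op R T => boxtimes G rho (psi *m adjmx psi)).
Local Notation amp := (fun x : T => psi (enum_rank x) 0).
Local Notation bx := (box (G 0 0) (G 0 1) (G 1 0) (G 1 1)).

Let chiD_ := chiD R pd.
Let norm_chi_ := @norm_chi R d.
Let chi_faithful_ := @chi_faithful R d pd.

Let det0' : G 0 0 * G 1 1 - G 0 1 * G 1 0 != 0.
Proof. by rewrite -det_mx2. Qed.

Let amp1 : \sum_x `|amp x| ^+ 2 = 1.
Proof.
rewrite -psi1 mxE sum_enum_val; apply: eq_bigr => i _.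
by rewrite mxE enum_valK normCK mulrC.
Qed.

Lemma card_Idx : #|{: T}| = (d ^ n)%N.
Proof. by rewrite card_ffun card_Fp // card_ord. Qed.

Let entropy_max : ln (#|T|%:R : R) = n%:R * ln (d%:R : R).
Proof. by rewrite card_Idx natrX lnXn ?ltr0n ?prime_gt0 // mulr_natl. Qed.

Lemma ent_output rho : ent (E rho) = bx (ent rho) (proj amp).
Proof.
apply/funext => x; apply/funext => y; rewrite ent_boxtimes //; congr (bx _ _ _ _).
by apply/funext => z; apply/funext => w; rewrite /ent mxE big_ord1 mxE.
Qed.

Lemma output_density rho : is_density rho -> is_density (E rho).
Proof.
move=> /is_densityE [pr tr]; apply/is_densityE; rewrite ent_output; split.
  exact: poskernel_box.
have scl0 a b : scl2 a b (0 : (T * T)%type) = 0.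
  by congr pair; apply/ffunP => j; rewrite !ffunE mulr0.
(* The characteristic function at 0 is the trace, so traces multiply. *)
have := charf_box det0' chiD_ (ent rho) (proj amp) 0; rewrite !scl0 !charf0 //.
by rewrite tr proj_trace amp1 mulr1.
Qed.

Lemma holevo_quantities_le x : holevo_quantities E x ->
  exists m (p : 'I_m -> R) (rhos : 'I_m -> Op R T),
   [/\ forall k, 0 <= p k, \sum_k p k = 1, forall k, is_density (rhos k) &
       x <= n%:R * ln d%:R - \sum_k p k * vN_entropy (E (rhos k))].
Proof.
move=> [m [p [rhos [p0 [p1 [dr ->]]]]]]; exists m, p, rhos; split=> //.
rewrite lerD2r -entropy_max; apply/entropy_le/is_density_mix => // k.
exact: output_density.
Qed.

Lemma capacity_ubound : ubound (holevo_quantities E) (n%:R * ln d%:R).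
Proof.
move=> x /holevo_quantities_le [m [p [rhos [p0 p1 dr xle]]]].
apply: le_trans xle _; rewrite gerBl; apply: sumr_ge0 => k _.
apply: mulr_ge0 => //; exact/entropy_ge0/output_density.
Qed.

Lemma stabilizer_of_capacity :
  holevo_capacity E = n%:R * ln d%:R -> stabilizer_state psi.
Proof.
move=> cap.
have cap0 : 0 < n%:R * ln d%:R :> R by rewrite mulr_gt0 ?ltr0n // ln_gt0 // ltr1n prime_gt1.
have hs : has_sup (holevo_quantities E).
  (* [sup] is 0 by default on a set without a supremum, whereas the capacity is positive here. *)
  apply/not_notP => /sup_out; rewrite -/(holevo_capacity E) cap => c0.
  by rewrite c0 ltxx in cap0.
have [|S [cS SE]] := @stabilizer_of_almost_pure _ _ _ _ chiD_ norm_chi_ chi_faithful_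
    _ _ _ _ (G0 0 0) (G0 0 1) (G0 1 0) (G0 1 1) det0' amp amp1.
  move=> eps eps0; have epsE : eps = (complex.Re eps)%:C%C.
    by rewrite RRe_real // gtr0_real.
  move: eps0; rewrite epsE (ltcR 0); move: (complex.Re eps) => r r0.
  have [x /holevo_quantities_le [m [p [rhos [p0 p1 dr xle]]]]] := sup_adherent r0 hs.
  rewrite -/(holevo_capacity E) cap => xgt.
  have Hlt : \sum_k p k * vN_entropy (E (rhos k)) < r by lra.
  (* A weighted mean below [r] has a member below [r]. *)
  have [k Hk] : exists k, vN_entropy (E (rhos k)) < r.
    apply/not_existsP => H; move: Hlt; apply/negP; rewrite -leNgt.
    rewrite -[leLHS]mul1r -p1 mulr_suml; apply: ler_sum => k _.
    by rewrite ler_wpM2l // leNgt; apply/negP; exact: H.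
  have dk := dr k; exists (ent (rhos k)); have /is_densityE[pk tk] := dk.
  split=> //; first exact: density_purity_le1.
  rewrite -ent_output; apply: le_trans (entropy_ge_linear (output_density dk)).
  by rewrite lerD2l lerN2 lecR ltW.
exists S; split.
- by rewrite cS card_Idx.
- by apply/SE; apply: eigen0.
- by move=> u v /SE eu /SE ev; apply/SE; apply: eigenD.
- move=> u v /SE eu /SE ev; apply: weyl_comm => //.
  exact: (eigen_symp0 chiD_ norm_chi_ chi_faithful_ amp1 eu ev).
- by move=> u /SE eu; apply/weyl_eigen.
Qed.

Lemma capacity_of_stabilizer :
  stabilizer_state psi -> holevo_capacity E = n%:R * ln d%:R.
Proof.
move=> [S [cS _ _ _ eS]].
have [||phi [phi1 phib phiE]] := @pure_outputs _ _ _ _ chiD_ norm_chi_ chi_faithful_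
    _ _ _ _ (G0 0 1) (G0 1 0) det0' amp amp1 S.
- by rewrite cS card_Idx.
- by move=> u /eS uS; apply/weyl_eigen.
pose rhos i : Op R T := mxF (proj (phi i)).
have entr i : ent (rhos i) = proj (phi i).
  by apply/funext => x; apply/funext => y; rewrite ent_mxF.
have dr i : is_density (rhos i).
  apply/is_densityE; rewrite entr proj_trace phi1; split=> //; exact: poskernel_proj.
have T0 : 0 < #|{: T}|%:R :> R by rewrite ltr0n card_Idx expn_gt0 prime_gt0.
pose p (i : 'I_#|{: T}|) : R := #|{: T}|%:R^-1.
have p0 i : 0 <= p i by rewrite invr_ge0 ltW.
have p1 : \sum_i p i = 1.
  by rewrite sumr_const card_ord -[_ *+ #|_|]mulr_natl divff // gt_eqF.
have H0 i : vN_entropy (E (rhos i)) = 0.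
  apply: entropy_pure; first exact: output_density.
  by rewrite ent_output entr.
set avg := \sum_i (p i)%:C%C *: E (rhos i).
have davg : is_density avg by apply: is_density_mix => // i; exact: output_density.
(* By linearity the uniform mixture of the eigenbasis, [I / d^n], passes through the channel
   unchanged. *)
have eavg x y : ent avg x y = (#|{: T}|%:R^-1)%:C%C * (x == y)%:R.
  rewrite ent_sum /p -mulr_sumr; congr (_ * _).
  under eq_bigr do rewrite ent_output entr.
  rewrite exchange_big /=.
  under eq_bigr do rewrite -mulr_suml phib.
  have := box_delta (G 0 1) (G 1 0) (proj amp) x y (G0 0 0) (G0 1 1).
  by rewrite proj_trace amp1 mulr1 => <-.
have Havg : vN_entropy avg = n%:R * ln d%:R.
  rewrite -entropy_max; apply/eqP; rewrite eq_le (entropy_le davg) /=.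
  have <- : - ln (#|{: T}|%:R^-1) = ln (#|{: T}|%:R : R) by rewrite lnV ?posrE // opprK.
  (* The purity of [I / d^n] is [1 / d^n], so the order-2 bound already reaches the maximum. *)
  apply: entropy_ge_ln => //; rewrite /purity.
  transitivity (\sum_(x : T) ((#|{: T}|%:R^-1)%:C%C : R[i]) ^+ 2).
    apply: eq_bigr => x _; rewrite (bigD1 x) //= big1 => [|y /negbTE xy].
      by rewrite eavg eqxx mulr1 addr0 ger0_norm // ler0c invr_ge0 ltW.
    by rewrite eavg eq_sym xy mulr0 normr0 expr0n.
  rewrite sumr_const -rmorphXn -rmorphMn; congr (_%:C%C).
  by rewrite -[_ *+ #|_|]mulr_natr expr2 mulfVK // gt_eqF.
have inS : holevo_quantities E (n%:R * ln d%:R).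
  exists #|{: T}|, p, rhos; split=> //; split=> //; split=> //.
  by rewrite -/avg Havg big1 ?subr0 // => i _; rewrite H0 mulr0.
apply/eqP; rewrite eq_le; apply/andP; split.
  by apply: ge_sup; [exists (n%:R * ln d%:R) | exact: capacity_ubound].
by apply: ub_le_sup => //; exists (n%:R * ln d%:R); exact: capacity_ubound.
Qed.

End Capacity.

Local Open Scope complex_scope.

Theorem mainTheorem16 (R : realType) (d n : nat) (G : 'M['F_d]_2)
    (psi : 'cV[R[i]]_#|Idx d n|) :
  prime d -> (0 < n)%N ->
  (forall a b, G a b != 0) -> \det G != 0 ->
  (adjmx psi *m psi) 0 0 = 1 ->
  (holevo_capacity (fun rho : Op R (Idx d n) => boxtimes G rho (psi *m adjmx psi))
     = n%:R * ln (d%:R : R)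
   <-> stabilizer_state psi).
Proof.
move=> pd n_gt0 G0 det0 psi1; split; first exact: stabilizer_of_capacity.
exact: capacity_of_stabilizer.
Qed.
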